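(* Let $S$ be a nonnegative $k\times l$ integer matrix. Then $S$ is the slack matrix of a positive affine semigroup if and only if the following conditions hold. (1) $K^{\mathrm{row}}_S=\mathbb{R}^l_+\cap\operatorname{Row}(S)$, $\Lambda^{\mathrm{row}}_S=\mathbb{Z}^l\cap\operatorname{Row}(S)$, and the rows of $S$ are a minimal generating set for $\Gamma^{\mathrm{row}}_S$; (2) the columns of $S$ are a minimal generating set for $\mathbb{Z}^k_+\cap\operatorname{Col}(S)$.
   Context: $\mathbb{Z}_+$ and $\mathbb{R}_+$ denote the nonnegative integers and nonnegative reals. An affine semigroup is a set $\Gamma=\{\sum_{i=1}^k m_iv_i \mid m_i\in\mathbb{Z}_+\}\subseteq\mathbb{R}^n$, for some $v_1,\dots,v_k\in\mathbb{R}^n$, such that $\Lambda_\Gamma=\{x-y\mid x,y\in\Gamma\}$ is a lattice (a discrete additive subgroup of $\mathbb{R}^n$). It is positive if $0$ is the only $x\in\Gamma$ with $-x\in\Gamma$. A positive affine semigroup has a unique minimal generating set. The dual of $\Gamma$ is $\Gamma^*=\{w\in\operatorname{span}(\Gamma)\mid \langle w,a\rangle\in\mathbb{Z}_+\text{ for all }a\in\Gamma\}$; for positive $\Gamma$ it is again a positive affine semigroup. Slack matrix: if $a_1,\dots,a_k$ and $b_1,\dots,b_l$ are the minimal generating sets (listed in some order, without repetition) of $\Gamma$ and $\Gamma^*$, the slack matrix of $\Gamma$ is the matrix in $\mathbb{Z}_+^{k\times l}$ with $(i,j)$-entry $\langle a_i,b_j\rangle$; it is defined up to row and column permutations. For a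 $k\times l$ integer matrix $S$: $\operatorname{Row}(S)\subseteq\mathbb{R}^l$ and $\operatorname{Col}(S)\subseteq\mathbb{R}^k$ are the real row and column spaces; $\Gamma_S^{\mathrm{row}}$, $\Lambda_S^{\mathrm{row}}$, $K_S^{\mathrm{row}}$ are respectively the sets of all nonnegative integer, all integer, and all nonnegative real combinations of the rows of $S$. Saying that the rows (columns) are a minimal generating set means that they generate the semigroup under nonnegative integer combinations and that none of them can be omitted (in particular there are no repetitions). *)

(* Defs.v *)
From mathcomp Require Import all_boot all_order all_algebra.
From mathcomp Require Import all_classical all_reals all_analysis.

Set Implicit Arguments.
Unset Strict Implicit.
Unset Printing Implicit Defensive.

Import Order.TTheory GRing.Theory Num.Theory.
Import numFieldNormedType.Exports.

Local Open Scope classical_set_scope.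
Local Open Scope ring_scope.

Section Combinations.
Variables (R : realType) (V : lmodType R) (I : finType).
Implicit Types (v : I -> V) (P : pred I) (G : set V).

(* Only the v i with P i are used, so that members of the family can be
   left out in min_generating below. *)
Definition nat_comb P v : set V :=
  [set x | exists m : I -> nat, x = \sum_(i | P i) v i *+ m i].

Definition int_comb v : set V :=
  [set x | exists m : I -> int, x = \sum_i v i *~ m i].

Definition nneg_comb v : set V :=
  [set x | exists c : I -> R, (forall i, 0 <= c i) /\ x = \sum_i c i *: v i].

(* Irredundancy forces v to be injective. *)
Definition min_generating v G :=
  nat_comb predT v = G /\ forall i, nat_comb (predC1 i) v <> G.

End Combinations.

Section AffineSemigroups.
Variables (R : realType) (n : nat).
Implicit Types (u w : 'rV[R]_n) (G : set 'rV[R]_n).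

Definition dotmx u w : R := (u *m w^T) 0 0.

Definition difference_group G : set 'rV[R]_n :=
  [set z | exists x y, [/\ G x, G y & z = x - y]].

(* The difference group of a finitely generated G is always an additive
   subgroup, so it is a lattice as soon as all its points are isolated. *)
Definition affine_semigroup G :=
  (exists k (v : 'I_k -> 'rV[R]_n), G = nat_comb predT v) /\
  isolated (difference_group G) = difference_group G.

Definition positive_affine_semigroup G :=
  affine_semigroup G /\ forall x, G x -> G (- x) -> x = 0.

Definition linear_span G : set 'rV[R]_n :=
  [set x | exists m (a : 'I_m -> 'rV[R]_n) (c : 'I_m -> R),
     (forall i, G (a i)) /\ x = \sum_i c i *: a i].

Definition dual_semigroup G : set 'rV[R]_n :=
  [set w | linear_span G w /\ forall a, G a -> dotmx w a \is a Num.nat].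

Definition is_slack_matrix_of k l (S : 'M[int]_(k, l)) G :=
  exists (a : 'I_k -> 'rV[R]_n) (b : 'I_l -> 'rV[R]_n),
    [/\ min_generating a G, min_generating b (dual_semigroup G)
      & forall i j, (S i j)%:~R = dotmx (a i) (b j)].

End AffineSemigroups.

Section IntegerMatrices.
Variables (R : realType) (k l : nat) (S : 'M[int]_(k, l)).

Definition realmx : 'M[R]_(k, l) := map_mx intr S.

Definition row_space : set 'rV[R]_l := [set x | (x <= realmx)%MS].
Definition col_space : set 'cV[R]_k := [set y | (y^T <= realmx^T)%MS].

Definition realrow (i : 'I_k) : 'rV[R]_l := row i realmx.
Definition realcol (j : 'I_l) : 'cV[R]_k := col j realmx.

Definition row_semigroup : set 'rV[R]_l := nat_comb predT realrow.
Definition row_lattice : set 'rV[R]_l := int_comb realrow.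
Definition row_cone : set 'rV[R]_l := nneg_comb realrow.

End IntegerMatrices.

Arguments realmx R {k l} S.
Arguments row_space R {k l} S _.
Arguments col_space R {k l} S _.
Arguments realrow R {k l} S i.
Arguments realcol R {k l} S j.
Arguments row_semigroup R {k l} S _.
Arguments row_lattice R {k l} S _.
Arguments row_cone R {k l} S _.

(* Main.v *)
(* Choose a basis F of the lattice of G and write the generators of G as M F with
   M integral; it exists because discreteness gives the generators rational
   coordinates in a maximal independent subfamily, after which the Smith normal form
   applies. In the dual coordinates the generators of the dual become an integral
   matrix U with S = M U, whose columns generate {u integral | M u >= 0}. Since G
   is positive, some integral u satisfies M u > 0, so the columns of U generate
   the whole integral lattice: both M and U have one-sided integral inverses,
   which gives the lattice equalities. Farkas' lemma with integral normals gives
   the equality of cones. Conversely, for S as in (1) and (2), the semigroup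
   generated by the rows of S works, its dual being generated by the orthogonal
   projections of the unit vectors onto Row(S). *)
Require Import Defs.
From mathcomp Require Import all_boot all_order all_algebra.
From mathcomp Require Import all_classical all_reals all_analysis.
From mathcomp Require Import lra ring zify.

Set Implicit Arguments.
Unset Strict Implicit.
Unset Printing Implicit Defensive.

Import Order.TTheory GRing.Theory Num.Theory.
Import numFieldNormedType.Exports.
Import Defs.

Local Open Scope classical_set_scope.
Local Open Scope ring_scope.

Lemma map_intr_real_inj (R : numDomainType) m n :
  injective (fun A : 'M[int]_(m, n) => map_mx (intr : int -> R) A).
Proof.
move=> A B /matrixP eqAB; apply/matrixP => i j.
by have := eqAB i j; rewrite !mxE => /intr_inj.
Qed.

(** * Integral cones: Fourier-Motzkin elimination, Farkas' lemma, positive functionals *)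

Definition pairing (R : pzRingType) r (y : 'rV[R]_r) (w : 'cV[R]_r) : R :=
  (y *m w) 0 0.

Lemma pairing_row (R : pzRingType) k r (M : 'M[R]_(k, r)) i (w : 'cV_r) :
  pairing (row i M) w = (M *m w) i 0.
Proof. by rewrite /pairing -row_mul [LHS]mxE. Qed.

(* Fourier-Motzkin elimination: integral inner normals of the cone generated by
   s, obtained by projecting out the coefficient of the head of s. *)
Fixpoint cone_normals r (s : seq 'rV[int]_r) : seq 'cV[int]_r :=
  if s is a :: s' then
    let W := cone_normals s' in
    [seq w <- W | 0 <= pairing a w] ++
    [seq pairing a p *: q - pairing a q *: p
      | p <- [seq w <- W | 0 < pairing a w], q <- [seq w <- W | pairing a w < 0]]
  else [seq delta_mx i 0 | i <- enum 'I_r] ++ [seq - delta_mx i 0 | i <- enum 'I_r].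

Lemma pairingZB (R : comPzRingType) r (y : 'rV[R]_r) (p q : 'cV_r) (a b : R) :
  pairing y (a *: q - b *: p) = a * pairing y q - b * pairing y p.
Proof. by rewrite /pairing mulmxBr -!scalemxAr !mxE. Qed.

(** A combined normal vanishes on the head [a], and on the tail it is a nonnegative combination of
    the two normals it comes from. *)
Lemma cone_normals_ge0 r (s : seq 'rV[int]_r) w a :
  w \in cone_normals s -> a \in s -> 0 <= pairing a w.
Proof.
elim: s w a => //= a s IH w b.
rewrite mem_cat => /orP[|/allpairsP[[p q]] /= []].
  by rewrite mem_filter inE => /andP[aw wW] /predU1P[->//|/IH]; apply.
rewrite !mem_filter => /andP[ap pW] /andP[aq qW] ->.
rewrite pairingZB inE => /predU1P[->|bs]; first by rewrite mulrC subrr.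
by rewrite subr_ge0 (le_trans (y := 0)) //
  ?mulr_le0_ge0 ?mulr_ge0 ?(ltW ap) ?(ltW aq) ?IH.
Qed.

(** [K] is kept abstract to serve twice: as the cone itself in Farkas' lemma, and over [rat] as the
    set of points with a positive multiple in the semigroup of the rows. *)
Lemma cone_normals_sufficient (R : realFieldType) r (s : seq 'rV[int]_r)
    (K : 'rV[R]_r -> Prop) (y : 'rV[R]_r) :
  K 0 ->
  (forall a x t, a \in s -> 0 <= t -> K x -> K (x + t *: map_mx intr a)) ->
  (forall w, w \in cone_normals s -> 0 <= pairing y (map_mx intr w)) -> K y.
Proof.
move=> K0; elim: s y => [|a s IH] y KD yW.
  suff -> : y = 0 by [].
  apply/rowP => i; rewrite mxE; apply/eqP; rewrite eq_le.
  have yi : pairing y (map_mx intr (delta_mx i 0)) = y 0 i.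
    by rewrite map_delta_mx /pairing -colE mxE.
  have yNi : pairing y (map_mx intr (- delta_mx i 0)) = - y 0 i.
    by rewrite map_mxN map_delta_mx /pairing mulmxN -colE !mxE.
  apply/andP; split.
    rewrite -oppr_ge0 -yNi; apply: yW.
    by rewrite mem_cat; apply/orP; right; apply/mapP; exists i; rewrite ?mem_enum.
  rewrite -yi; apply: yW; rewrite mem_cat; apply/orP; left.
  by apply/mapP; exists i; rewrite ?mem_enum.
pose ar := map_mx (intr : int -> R) a.
have prI w : pairing ar (map_mx intr w) = (pairing a w)%:~R.
  by rewrite /pairing -map_mxM mxE.
pose W := cone_normals s.
pose ratio w := pairing y (map_mx intr w) / pairing ar (map_mx intr w).
(* The least admissible coefficient of [a] in a representation of [y]. *)
pose t := \big[Num.max/0]_(w <- W | pairing a w < 0) ratio w.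
have t0 : 0 <= t by apply: Order.TotalTheory.bigmax_ge_id.
rewrite -(subrK (t *: ar) y); apply: (KD a) => //; first by rewrite inE eqxx.
apply: IH => [b x u bs|w wW]; first by apply: KD; rewrite inE bs orbT.
have -> : pairing (y - t *: ar) (map_mx intr w) =
  pairing y (map_mx intr w) - t * (pairing a w)%:~R.
  by rewrite -prI /pairing mulmxBl -scalemxAl !mxE.
rewrite subr_ge0; have [aw|aw|aw] := ltrgtP (pairing a w) 0; last first.
- by rewrite aw mulr0; apply: yW; rewrite /= mem_cat mem_filter aw lexx wW.
(* Here [w] bounds [t] from above: [w] is itself a normal, so [ratio w] is nonnegative, and for each
   [q] in the maximum the combined normal of [w] and [q] gives [ratio q <= ratio w]. *)
- have aw' : 0 < (pairing a w)%:~R :> R by rewrite ltr0z.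
  rewrite -ler_pdivlMr// /t big_seq_cond; elim/big_ind: _ => [|u v uw vw|q /andP[qW aq]].
  + apply: divr_ge0; last exact: ltW; apply: yW.
    by rewrite /= mem_cat mem_filter (ltW aw) wW.
  + by rewrite ge_max uw vw.
  + have aq' : (pairing a q)%:~R < 0 :> R by rewrite ltrz0.
    rewrite /ratio prI ler_ndivrMr// mulrAC ler_pdivrMr// -subr_ge0.
    have : pairing a w *: q - pairing a q *: w \in cone_normals (a :: s).
      rewrite /= mem_cat; apply/orP; right; apply/allpairsP; exists (w, q).
      by rewrite !mem_filter aw aq.
    move=> /yW; rewrite map_mxB !map_mxZ pairingZB.
    by rewrite ![_ * (pairing _ _)%:~R]mulrC.
- have aw' : (pairing a w)%:~R < 0 :> R by rewrite ltrz0.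
  rewrite -ler_ndivrMr//.
  have := Order.TotalTheory.le_bigmax_seq 0 w (fun w => pairing a w < 0) ratio wW aw.
  by rewrite {1}/ratio prI.
Qed.

(** Integral test vectors suffice because elimination on integral generators produces integral
    normals. *)
Lemma integral_farkas (R : realFieldType) k r (M : 'M[int]_(k, r)) (y : 'rV[R]_r) :
  (forall w : 'cV[int]_r, (forall i, 0 <= (M *m w) i 0) ->
    0 <= pairing y (map_mx intr w)) ->
  exists c : 'rV[R]_k, (forall i, 0 <= c 0 i) /\ y = c *m map_mx intr M.
Proof.
move=> yM; apply: (@cone_normals_sufficient R r [seq row i M | i <- enum 'I_k]
  (fun x => exists c : 'rV[R]_k, (forall i, 0 <= c 0 i) /\ x = c *m map_mx intr M)).
- by exists 0; split=> [i|]; rewrite ?mxE ?mul0mx.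
- move=> _ x t /mapP[i _ ->] t0 [c [c0 ->]].
  exists (c + t *: delta_mx 0 i); split=> [j|].
    by rewrite !mxE addr_ge0// mulr_ge0// ler0n.
  by rewrite mulmxDl -scalemxAl -rowE map_row.
- move=> w wM; apply: yM => i.
  by rewrite -pairing_row; apply: (cone_normals_ge0 wM);
    apply/mapP; exists i; rewrite ?mem_enum.
Qed.

(** The sum of all normals works: if it vanished on row [i], so would every normal, minus row [i]
    would lie in the cone, and clearing denominators would give a nontrivial relation among the
    rows. *)
Lemma positive_functional k r (M : 'M[int]_(k, r)) :
  (forall m : 'I_k -> nat, \sum_i row i M *+ m i = 0 -> forall i, m i = 0%N) ->
  exists w : 'cV[int]_r, forall i, 0 < (M *m w) i 0.
Proof.
move=> Mpos; pose s := [seq row i M | i <- enum 'I_k].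
exists (\sum_(w <- cone_normals s) w) => i.
have sM j : row j M \in s by apply/mapP; exists j; rewrite ?mem_enum.
have -> : (M *m \sum_(w <- cone_normals s) w) i 0 =
    \sum_(w <- cone_normals s) pairing (row i M) w.
  rewrite mulmx_sumr summxE; apply: eq_bigr => w _.
  by rewrite pairing_row.
have pr_ge0 w : w \in cone_normals s -> 0 <= pairing (row i M) w.
  by move=> /cone_normals_ge0; apply.
rewrite lt_neqAle big_seq sumr_ge0// andbT eq_sym psumr_eq0//.
apply/negP => /allP pr0.
pose Mq := map_mx (intr : int -> rat) M.
have MqE j : map_mx intr (row j M) = row j Mq by exact: map_row.
have [N [m [N0 NE]]] : exists N (m : 'I_k -> nat),
    (0 < N)%N /\ - row i Mq *+ N = \sum_j row j Mq *+ m j.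
  apply: (@cone_normals_sufficient rat r s
    (fun x => exists N (m : 'I_k -> nat),
       (0 < N)%N /\ x *+ N = \sum_j row j Mq *+ m j)).
  - by exists 1%N, (fun=> 0%N); rewrite mul0rn big1.
  - move=> _ x t /mapP[j _ ->] t0 [N [m [N0 NE]]].
    have [p [q [q0 ->]]] : exists (p q : nat), (0 < q)%N /\ t = p%:R / q%:R.
      exists `|numq t|%N, `|denq t|%N.
      rewrite absz_gt0 denq_neq0 !natr_absz.
      by rewrite !ger0_norm ?denq_ge0 ?numq_ge0// divq_num_den.
    (* With [t = p / q], multiplying [x + t a] by [N q] gives [q] times the relation for [x] plus
       [p N] copies of [a]. *)
    exists (N * q)%N, (fun h => m h * q + (j == h) * (p * N))%N.
    rewrite muln_gt0 N0 q0; split=> //.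
    under eq_bigr do rewrite mulrnDr mulrnA.
    rewrite big_split/= sumrMnl -NE mulrnDl mulrnA; congr (_ + _).
    rewrite (bigD1 j)//= eqxx mul1n big1 ?addr0 => [|h]; last first.
      by rewrite eq_sym => /negPf ->; rewrite mul0n.
    rewrite MqE -[LHS]scaler_nat -[RHS]scaler_nat scalerA; congr (_ *: _).
    by rewrite !natrM; field; rewrite pnatr_eq0 -lt0n.
  - move=> w ws; have := pr0 _ ws; rewrite ws/= => /eqP pw.
    rewrite /pairing /Mq -map_row mulNmx -map_mxM !mxE.
    by move: pw; rewrite /pairing mxE => ->; rewrite oppr0.
have : N = 0%N; last by move=> E; rewrite E in N0.
suff /Mpos/(_ i) : \sum_j row j M *+ (m j + (i == j) * N) = 0.
  by rewrite eqxx mul1n => /eqP; rewrite addn_eq0 => /andP[_ /eqP].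
apply: (@map_intr_real_inj rat); rewrite map_mx0.
rewrite map_mx_sum.
under eq_bigr do rewrite raddfMn/= MqE mulrnDr.
rewrite big_split/= -NE (bigD1 i)//= eqxx mul1n big1 ?addr0 => [|j].
  by rewrite mulNrn addNr.
by rewrite eq_sym => /negPf ->; rewrite mul0n.
Qed.

(* A strictly positive functional w turns any integral u into the difference of
   the two dual elements u + N w and N w. *)
Lemma dual_generators_unimodular k r l (M : 'M[int]_(k, r)) (U : 'M[int]_(r, l)) :
  (forall m : 'I_k -> nat, \sum_i row i M *+ m i = 0 -> forall i, m i = 0%N) ->
  (forall u : 'cV[int]_r, (forall i, 0 <= (M *m u) i 0) ->
     exists2 z : 'cV[int]_l, (forall j, 0 <= z j 0) & u = U *m z) ->
  exists U' : 'M[int]_(l, r), U *m U' = 1%:M.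
Proof.
move=> /positive_functional[w w_gt0] Ugen.
suff /choice[z zE] (j : 'I_r) : exists z : 'cV_l, U *m z = delta_mx j 0.
  exists (\matrix_(i, j) z j i 0); apply/matrixP => i j.
  have /matrixP/(_ i 0) := zE j; rewrite !mxE eqxx andbT => <-.
  by apply: eq_bigr => h _; rewrite !mxE.
have [z0 _ z0E] := Ugen w (fun i => ltW (w_gt0 i)).
pose d : 'cV[int]_r := delta_mx j 0; pose N := \sum_i `|(M *m d) i 0|.
have [|z1 _ z1E] := Ugen (d + N *: w).
  move=> i; rewrite mulmxDr -scalemxAr [leRHS]mxE [X in _ + X]mxE.
  set x := (M *m d) i 0.
  have xN : `|x| <= N by rewrite /N (bigD1 i)//= lerDl sumr_ge0.
  have := w_gt0 i; set v := (M *m w) i 0 => v0.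
  have : N <= N * v by rewrite ler_peMr// sumr_ge0.
  have : - x <= `|x| by rewrite -normrN ler_norm.
  lia.
by exists (z1 - N *: z0); rewrite mulmxBr -scalemxAr -z1E -z0E addrK.
Qed.

(** * Discrete groups: rational coordinates and lattice bases *)

(* Dirichlet's pigeonhole argument on the fractional parts of the multiples of c. *)
Lemma simultaneous_approximation (R : archiRealFieldType) r (c : 'I_r -> R) (q : nat) :
  exists (N : nat) (m : 'I_r -> int),
    (0 < N)%N /\ forall j, `|c j *+ N - (m j)%:~R| < q.+1%:R^-1.
Proof.
pose fr (x : R) := x - (Num.floor x)%:~R.
have fr_ge0 x : 0 <= fr x by rewrite subr_ge0 ge_floor.
have fr_lt1 x : fr x < 1 by rewrite ltrBlDl -[1]/(1%:~R) -intrD floorD1_gt.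
have q_gt0 : 0 < q.+1%:R :> R by rewrite ltr0n.
pose T := {ffun 'I_r -> 'I_q.+1}.
(* One more multiple is taken than there are cells of side [1 / (q + 1)] in the unit cube. *)
pose cell (N : 'I_#|T|.+1) : T :=
  [ffun j => inord (Num.truncn (q.+1%:R * fr (c j *+ N)))].
have : ~~ injectiveb cell.
  by apply/injectiveP => /leq_card; rewrite card_ord ltnn.
move=> /injectivePn[N1 [N2 N12 cell12]].
wlog lt12 : N1 N2 N12 cell12 / (N2 < N1)%N => [hw|].
  case: (ltngtP N1 N2) => [lt12|lt21|eq12].
  - by apply: (hw N2 N1) => //; rewrite eq_sym.
  - exact: (hw N1 N2).
  - by move/eqP : N12 => []; apply: val_inj.
exists (N1 - N2)%N, (fun j => Num.floor (c j *+ N1) - Num.floor (c j *+ N2)).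
rewrite subn_gt0; split=> // j.
have -> : c j *+ (N1 - N2) - (Num.floor (c j *+ N1) - Num.floor (c j *+ N2))%:~R =
    fr (c j *+ N1) - fr (c j *+ N2).
  by rewrite mulrnBr ?(ltnW lt12)// intrB /fr; ring.
have : Num.truncn (q.+1%:R * fr (c j *+ N1)) = Num.truncn (q.+1%:R * fr (c j *+ N2)).
  have trunc_lt (N : nat) : (Num.truncn (q.+1%:R * fr (c j *+ N)) < q.+1)%N.
    by rewrite truncn_lt_nat ?mulr_ge0 ?ler0n ?fr_ge0// gtr_pMr.
  by move/ffunP/(_ j)/(congr1 val) : cell12; rewrite !ffunE/= !inordK.
set x := fr (c j *+ N1); set y := fr (c j *+ N2) => xy.
have /truncn_itv/andP[] : 0 <= q.+1%:R * x by rewrite mulr_ge0 ?ler0n ?fr_ge0.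
have /truncn_itv/andP[] : 0 <= q.+1%:R * y by rewrite mulr_ge0 ?ler0n ?fr_ge0.
rewrite xy -!natr1 => y1 y2 x1 x2.
rewrite -[ltRHS]mul1r ltr_pdivlMr// -[X in _ * X]gtr0_norm// -normrM.
by rewrite mulrC mulrBr ltr_norml; lra.
Qed.

(** Only the origin is separated from the other lattice points; translation carries this to every
    point. The coordinatewise bound matches the balls of the matrix topology. *)
Definition discrete_rows (R : realType) k n (A : 'M[R]_(k, n)) :=
  exists2 e : R, 0 < e & forall z : 'rV[int]_k,
    (forall j, `|(map_mx intr z *m A) 0 j| < e) -> map_mx intr z *m A = 0.

(* Discreteness makes a multiple of each row an integral combination of a row
   basis: a good approximation N c ~ m of its coordinates c gives a lattice
   vector too small to be nonzero. *)
Lemma discrete_rows_rational (R : realType) k n (A : 'M[R]_(k, n)) :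
  discrete_rows A ->
  exists (D : nat) (P : 'M[int]_(k, \rank A)),
    (0 < D)%N /\ D%:R *: A = map_mx intr P *m rowsub (maxrankfun A) A.
Proof.
move=> [e e0 disc]; set A0 := rowsub _ A.
suff /choice[Nm Nm_row] : forall i, exists Nm : nat * 'rV[int]_(\rank A),
    (0 < Nm.1)%N /\ Nm.1%:R *: row i A = map_mx intr Nm.2 *m A0.
  exists (\prod_i (Nm i).1)%N.
  exists (\matrix_i ((\prod_(j | j != i) (Nm j).1)%N%:Z *: (Nm i).2)).
  split; first by apply/prodn_gt0 => i; have [] := Nm_row i.
  apply/row_matrixP => i; rewrite row_mul -map_row rowK linearZ/=.
  rewrite map_mxZ/= -scalemxAl -(proj2 (Nm_row i)) scalerA (bigD1 i)//= natrM.
  by rewrite mulrC.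
move=> i; pose c := row i A *m pinvmx A0.
have cA0 : c *m A0 = row i A.
  by rewrite mulmxKpV// (submx_trans (row_sub i A))// eq_maxrowsub.
(* [B] exceeds every absolute column sum of [A0], so coordinates approximated within [1 / (q + 1)]
   give an error of at most [B / (q + 1)], which is below [e]. *)
pose B := 1 + \sum_h \sum_j `|A0 h j|.
have B0 : 0 < B.
  by rewrite ltr_pwDl// sumr_ge0// => h _; rewrite sumr_ge0.
pose q := Num.truncn (B / e).
have [N [m [N0 Nm]]] := simultaneous_approximation (fun h => c 0 h) q.
pose mr : 'rV[int]_(\rank A) := \row_h m h.
pose z := N%:Z *: delta_mx 0 i - mr *m rowsub (maxrankfun A) 1%:M.
have zA : map_mx intr z *m A = (N%:R *: c - map_mx intr mr) *m A0.
  rewrite /z map_mxB map_mxZ map_mxM map_delta_mx !mulmxBl -!scalemxAl -rowE cA0.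
  congr (_ - _).
  by rewrite -mulmxA map_mxsub map_mx1 mul_rowsub_mx mul1mx.
exists (N, mr); split=> //=.
rewrite -cA0 scalemxAl; apply/eqP; rewrite -subr_eq0 -mulmxBl -zA; apply/eqP.
apply: disc => j; rewrite zA mxE.
apply: (@le_lt_trans _ _ (\sum_h q.+1%:R^-1 * `|A0 h j|)).
  rewrite (le_trans (ler_norm_sum _ _ _))// ler_sum// => h _.
  rewrite normrM ler_wpM2r// ltW//; have := Nm h.
  by rewrite !mxE mulrC mulr_natr.
rewrite -mulr_sumr mulrC ltr_pdivrMr ?ltr0n//.
apply: (@le_lt_trans _ _ B); last first.
  by rewrite -ltr_pdivrMl// mulrC truncnS_gt.
rewrite ler_wpDl// ler_sum// => h _.
by rewrite (bigD1 j)//= lerDl sumr_ge0.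
Qed.

(** In the Smith form of [P] the unimodular left factor [L] acts on the generators: the first
    [\rank A] rows of [L^-1 A] form the basis. *)
Lemma lattice_basis (R : realType) k n (A : 'M[R]_(k, n)) :
  discrete_rows A ->
  exists r (F : 'M[R]_(r, n)) (M : 'M[int]_(k, r)) (M' : 'M[int]_(r, k)),
    [/\ row_free F, A = map_mx intr M *m F & F = map_mx intr M' *m A].
Proof.
move=> /discrete_rows_rational[D [P [D0 DA]]]; set A0 := rowsub _ A in DA.
have [L Lu [T Tu [d _ PE]]] := int_Smith_normal_form P.
have rk := rank_leq_row A.
pose dd : 'M[int]_(\rank A) := diag_mx (\row_j d`_j).
(* The rectangular Smith diagonal is split so that [F] can absorb the elementary divisors. *)
have PE' : P = L *m pid_mx (\rank A) *m dd *m T.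
  rewrite PE; congr (_ *m _); rewrite -mulmxA; congr (_ *m _).
  apply/matrixP => i j; rewrite mul_mx_diag !mxE.
  by case: eqP => [->|_]; rewrite ?mul0r ?ltn_ord ?mul1r.
pose F : 'M[R]_(\rank A, n) := D%:R^-1 *: (map_mx intr (dd *m T) *m A0).
have D0' : D%:R != 0 :> R by rewrite pnatr_eq0 -lt0n.
have AF : A = map_mx intr (L *m pid_mx (\rank A)) *m F.
  apply: (scalerI D0'); rewrite DA PE' /F -scalemxAr scalerA divff// scale1r.
  by rewrite mulmxA -map_mxM mulmxA.
exists (\rank A), F, (L *m pid_mx (\rank A)), (pid_mx (\rank A) *m invmx L); split=> //.
  (* [F] has [\rank A] rows, and [A = M F] forces its rank to be at least that. *)
  rewrite /row_free eqn_leq rank_leq_row/=.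
  by rewrite {1}AF mxrankM_maxr.
set X := pid_mx (\rank A) *m invmx L.
have -> : map_mx intr X *m A =
    map_mx intr X *m (map_mx intr (L *m pid_mx (\rank A)) *m F).
  by rewrite -AF.
rewrite mulmxA -map_mxM mulmxA mulmxKV//.
by rewrite pid_mx_id// pid_mx_1 map_mx1 mul1mx.
Qed.

(** * Transport of generating sets along linear maps *)

Lemma nat_comb_image (R : realType) (V W : lmodType R) (f : {linear V -> W})
    (I : finType) (P : pred I) (v : I -> V) :
  nat_comb P (f \o v) = f @` nat_comb P v.
Proof.
apply/seteqP; split=> [_ [m ->]|_ [_ [m ->] <-]].
  exists (\sum_(i | P i) v i *+ m i); first by exists m.
  by rewrite linear_sum; under eq_bigr do rewrite linearMn.
by exists m; rewrite linear_sum; under eq_bigr do rewrite linearMn.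
Qed.

Lemma image_injective_on (T U : Type) (f : T -> U) (D A B : set T) :
  (forall x y, D x -> D y -> f x = f y -> x = y) -> A `<=` D -> B `<=` D ->
  f @` A = f @` B -> A = B.
Proof.
move=> fI AD BD /seteqP[AB BA]; apply/seteqP; split=> x.
  by move=> Ax; have [y By /fI <-//] := AB _ (imageP f Ax); [apply: BD|apply: AD].
by move=> Bx; have [y Ay /fI <-//] := BA _ (imageP f Bx); [apply: AD|apply: BD].
Qed.

Lemma nat_comb_sub (R : realType) (V : lmodType R) (I : finType) (P : pred I)
    (v : I -> V) : nat_comb P v `<=` nat_comb predT v.
Proof.
move=> _ [m ->]; exists (fun i => P i * m i)%N.
rewrite big_mkcond; apply: eq_bigr => i _.
by case: (P i); rewrite ?mul1n.
Qed.

(** Injectivity is asked only on [D], since the maps used later, pairings with generators, are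
    injective just on a span. *)
Lemma min_generating_image (R : realType) (V W : lmodType R) (f : {linear V -> W})
    (I : finType) (v : I -> V) (D G : set V) :
  (forall x y, D x -> D y -> f x = f y -> x = y) ->
  G `<=` D -> nat_comb predT v `<=` D ->
  min_generating (f \o v) (f @` G) <-> min_generating v G.
Proof.
move=> fI GD vD; rewrite /min_generating nat_comb_image; split=> -[vG vmin].
  split=> [|i viG]; first exact: (image_injective_on fI vD GD vG).
  by apply: (vmin i); rewrite nat_comb_image viG.
split=> [|i]; first by rewrite vG.
rewrite nat_comb_image => viG; apply: (vmin i).
by apply: (image_injective_on fI _ GD viG); apply: subset_trans vD; apply: nat_comb_sub.
Qed.

(** * Semigroup, group and span generated by the rows of a matrix *)

Lemma nat_comb_rowP (R : realType) k n (A : 'M[R]_(k, n)) (x : 'rV[R]_n) :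
  nat_comb predT (fun i => row i A) x <->
  exists2 z : 'rV[int]_k, (forall i, 0 <= z 0 i) & x = map_mx intr z *m A.
Proof.
split=> [[m ->]|[z z0 ->]].
  exists (\row_i (m i)%:Z) => [i|]; first by rewrite mxE.
  by rewrite mulmx_sum_row; apply: eq_bigr => i _; rewrite !mxE -scaler_nat.
exists (fun i => absz (z 0 i)); rewrite mulmx_sum_row; apply: eq_bigr => i _.
by rewrite !mxE -scaler_nat natr_absz ger0_norm.
Qed.

Lemma difference_group_rows (R : realType) k n (A : 'M[R]_(k, n)) (z : 'rV[int]_k) :
  difference_group (nat_comb predT (fun i => row i A)) (map_mx intr z *m A).
Proof.
pose p := \row_i Num.max (z 0 i) 0; pose q := \row_i Num.max (- z 0 i) 0.
exists (map_mx intr p *m A), (map_mx intr q *m A); split.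
- by apply/nat_comb_rowP; exists p => // i; rewrite mxE le_max lexx orbT.
- by apply/nat_comb_rowP; exists q => // i; rewrite mxE le_max lexx orbT.
- rewrite -mulmxBl -map_mxB; congr (map_mx _ _ *m _).
  by apply/rowP => i; rewrite !mxE; lia.
Qed.

Lemma linear_span_rows (R : realType) k n (A : 'M[R]_(k, n)) :
  linear_span (nat_comb predT (fun i => row i A)) = [set x | (x <= A)%MS].
Proof.
apply/seteqP; split=> [_ [m [a [c [aG ->]]]]|x /submxP[c ->]].
  apply: summx_sub => i _; apply: scalemx_sub.
  by have /nat_comb_rowP[z _ ->] := aG i; apply: submxMl.
exists k, (fun i => row i A), (fun i => c 0 i); split; last exact: mulmx_sum_row.
move=> i; apply/nat_comb_rowP; exists (delta_mx 0 i) => [j|].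
  by rewrite mxE ler0n.
by rewrite map_delta_mx -rowE.
Qed.

(** * Orthogonal projection and the dual semigroup *)

Lemma mul_tr_eq0 (R : realFieldType) m n (X : 'M[R]_(m, n)) : X *m X^T = 0 -> X = 0.
Proof.
move=> XX; apply/matrixP => i j; rewrite mxE; apply/eqP.
have /matrixP/(_ i i)/eqP := XX; rewrite !mxE psumr_eq0 => [|h _].
  by move=> /allP/(_ j); rewrite mem_index_enum mxE mulf_eq0 orbb; apply.
by rewrite mxE -expr2 sqr_ge0.
Qed.

(** If [v A A^T = 0] then [v A] has norm zero, so [A A^T] and [A] have the same left kernel and
    hence the same rank. *)
Lemma trmx_sub_gram (R : realFieldType) m n (A : 'M[R]_(m, n)) : (A^T <= A *m A^T)%MS.
Proof.
rewrite -(geq_leqif (mxrank_leqif_sup (submxMl A A^T))) mxrank_tr.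
have : (kermx (A *m A^T) <= kermx A)%MS.
  apply/sub_kermxP/mul_tr_eq0.
  by rewrite trmx_mul mulmxA -(mulmxA _ A) mulmx_ker mul0mx.
by move=> /mxrankS; rewrite !mxrank_ker leq_sub2lE ?rank_leq_row.
Qed.

(** The witness is the orthogonal projection of [v^T] onto the row space. *)
Lemma row_space_preimage (R : realFieldType) m n (A : 'M[R]_(m, n)) (v : 'cV[R]_n) :
  exists2 w : 'rV[R]_n, (w <= A)%MS & A *m w^T = A *m v.
Proof.
have /submxP[X AX] := trmx_sub_gram A.
exists (v^T *m X *m A); first exact: submxMl.
apply: trmx_inj; by rewrite trmx_mul trmxK -!mulmxA -AX -trmx_mul.
Qed.

(** The difference lies in the row space and is orthogonal to it. *)
Lemma mulmx_tr_inj (R : realFieldType) m n (A : 'M[R]_(m, n)) (x y : 'rV[R]_n) :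
  (x <= A)%MS -> (y <= A)%MS -> A *m x^T = A *m y^T -> x = y.
Proof.
move=> xA yA /eqP; rewrite -subr_eq0 -mulmxBr -linearB/= => /eqP Axy.
have /submxP[d dE] : (x - y <= A)%MS by rewrite addmx_sub// eqmx_opp.
apply/eqP; rewrite -subr_eq0; apply/eqP; apply: mul_tr_eq0.
by rewrite {1}dE -mulmxA Axy mulmx0.
Qed.

Lemma dotmx_mulmx (R : realType) k n (z : 'rV[R]_k) (A : 'M[R]_(k, n)) (w : 'rV[R]_n) :
  dotmx w (z *m A) = \sum_i z 0 i * (A *m w^T) i 0.
Proof. by rewrite /dotmx -[_ *m _]trmxK trmx_mul trmxK -mulmxA [LHS]mxE [LHS]mxE. Qed.

Lemma dotmx_row (R : realType) k n (A : 'M[R]_(k, n)) i (w : 'rV[R]_n) :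
  dotmx w (row i A) = (A *m w^T) i 0.
Proof.
rewrite rowE dotmx_mulmx (bigD1 i)//= mxE !eqxx mul1r big1 ?addr0// => j ji.
by rewrite mxE (negPf ji) mul0r.
Qed.

Lemma dual_semigroup_rowsP (R : realType) k n (A : 'M[R]_(k, n)) (w : 'rV[R]_n) :
  dual_semigroup (nat_comb predT (fun i => row i A)) w <->
  (w <= A)%MS /\ A *m w^T \is a mxOver Num.nat.
Proof.
rewrite /dual_semigroup linear_span_rows /=.
split=> -[wA wn]; split=> //.
  apply/mxOverP => i j; rewrite ord1.
  rewrite -dotmx_row; apply: wn; apply/nat_comb_rowP; exists (delta_mx 0 i) => [h|].
    by rewrite mxE ler0n.
  by rewrite map_delta_mx -rowE.
move=> _ /nat_comb_rowP[z z0 ->]; rewrite dotmx_mulmx; apply: rpred_sum => i _.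
apply: rpredM; last by apply: (mxOverP wn).
by rewrite mxE; case: (z 0 i) (z0 i) => // p _; apply: natr_nat.
Qed.

(** Pairings with the generators serve as coordinates on the dual; for [A] the real form of [S] they
    turn it into the semigroup of condition (2). *)
Lemma dual_semigroup_image (R : realType) k n (A : 'M[R]_(k, n)) :
  (fun w => A *m w^T) @` dual_semigroup (nat_comb predT (fun i => row i A)) =
  [set y | y \is a mxOver Num.nat] `&` [set y | (y^T <= A^T)%MS].
Proof.
apply/seteqP; split=> [_ [w /dual_semigroup_rowsP[wA wn] <-]|y [yn yA]].
  by split=> //=; rewrite trmx_mul trmxK submxMl.
have /submxP[d yE] := yA.
have [w wA wE] := row_space_preimage A d^T.
have {}yE : y = A *m w^T by rewrite wE; apply: trmx_inj; rewrite trmx_mul trmxK.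
by exists w => //; apply/dual_semigroup_rowsP; rewrite -yE.
Qed.

(** * Isolated points of lattices, and minimal generators of the dual *)

Lemma discrete_lattice_rows (R : realType) k n (A : 'M[R]_(k, n)) :
  let L := difference_group (nat_comb predT (fun i => row i A)) in
  isolated L = L -> discrete_rows A.
Proof.
move=> L Liso; have L0 : L 0.
  by have := difference_group_rows A 0; rewrite map_mx0 mul0mx.
move: (L0); rewrite -{1}Liso => -[_ [V /nbhs_ballP[e /= e0 eV] VL]].
exists e => // z zA; have : (V `&` L) (map_mx intr z *m A); last by rewrite VL.
split; last exact: difference_group_rows.
apply: eV; split=> // i j; rewrite ord1 mxE.
by rewrite -ball_normE /= sub0r normrN.
Qed.

(** Distinct integral vectors differ by at least 1 in some coordinate, so unit balls isolate. *)
Lemma isolated_integral_lattice (R : realType) n (L : set 'rV[R]_n) :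
  (forall x, L x -> x \is a mxOver Num.int) -> isolated L = L.
Proof.
move=> Lint; apply/seteqP; split=> x; first by case=> /set_mem.
move=> Lx; split; first exact: mem_set.
exists (ball x 1); first exact: nbhsx_ballx.
apply/seteqP; split=> [y [[_ xy] Ly]|_ ->]; last by split=> //; apply: ballxx.
apply/rowP => j; have := xy 0 j; rewrite -ball_normE /=.
have /intrP[p ->] := mxOverP (Lint _ Lx) 0 j.
have /intrP[q ->] := mxOverP (Lint _ Ly) 0 j.
by rewrite -intrB -intr_norm ltrz1 => pq; congr (_%:~R); lia.
Qed.

Lemma min_generating_pairing (R : realType) k n l (A : 'M[R]_(k, n))
    (b : 'I_l -> 'rV[R]_n) :
  (forall j, (b j <= A)%MS) ->
  min_generating (fun j => A *m (b j)^T)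
    ([set y | y \is a mxOver Num.nat] `&` [set y | (y^T <= A^T)%MS]) <->
  min_generating b (dual_semigroup (nat_comb predT (fun i => row i A))).
Proof.
move=> bA; rewrite -dual_semigroup_image.
pose f : {linear 'rV[R]_n -> 'cV[R]_k} := mulmx A \o trmx.
apply: (@min_generating_image _ _ _ f _ b [set w | (w <= A)%MS]).
- by move=> x y; apply: mulmx_tr_inj.
- by move=> w /dual_semigroup_rowsP[].
- by move=> _ [m ->]; apply: summx_sub => j _; rewrite -scaler_nat scalemx_sub.
Qed.

(** * From the conditions on the matrix to a semigroup *)

Lemma row_semigroup_slack (R : realType) k l (S : 'M[int]_(k, l)) :
  (forall i j, 0 <= S i j) ->
  min_generating (realrow R S) (row_semigroup R S) ->
  min_generating (realcol R S)
    ([set y | y \is a mxOver Num.nat] `&` col_space R S) ->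
  positive_affine_semigroup (row_semigroup R S) /\
  is_slack_matrix_of S (row_semigroup R S).
Proof.
move=> S_ge0 Srow Scol.
have Gge0 x : row_semigroup R S x -> forall j, 0 <= x 0 j.
  move=> [m ->] j; rewrite summxE sumr_ge0// => i _.
  by rewrite -scaler_nat !mxE mulr_ge0// ?ler0n ?ler0z.
have Gint x : row_semigroup R S x -> x \is a mxOver Num.int.
  move=> [m ->]; apply/mxOverP => i j; rewrite summxE; apply: rpred_sum => h _.
  by rewrite -scaler_nat !mxE rpredM ?rpred_nat ?intr_int.
split.
  split; first split; first by exists k, (realrow R S).
    by apply: isolated_integral_lattice => _
      [x [y [/Gint/mxOverP xi /Gint/mxOverP yi ->]]];
      apply/mxOverP => i j; rewrite !mxE rpredB.
  move=> x Gx GNx; apply/rowP => j; apply/eqP; rewrite mxE eq_le Gge0// andbT.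
  by rewrite -oppr_ge0; have := Gge0 _ GNx j; rewrite mxE.
(* Projecting the [j]-th unit vector onto the row space keeps its pairings with the rows, which form
   column [j]. *)
have /choice[b bP] j : exists w,
    (w <= realmx R S)%MS /\ realmx R S *m w^T = realcol R S j.
  have [w wS wE] := row_space_preimage (realmx R S) (delta_mx j 0).
  by exists w; rewrite wE -colE.
exists (realrow R S), b; split=> //; last first.
  move=> i j; rewrite /dotmx.
  have <- : (realcol R S j) i 0 = (S i j)%:~R by rewrite !mxE.
  by rewrite -(proj2 (bP j)) -row_mul [RHS]mxE.
apply/(min_generating_pairing (A := realmx R S)) => [j|]; first by case: (bP j).
congr (min_generating _ _) : Scol.
by apply/funext => j; case: (bP j).
Qed.

(** * From a semigroup to the conditions, in coordinates of a lattice basis *)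

Section IntegralFactorization.
Variables (R : realType) (k n r l : nat) (A : 'M[R]_(k, n)) (b : 'I_l -> 'rV[R]_n).
Variables (S : 'M[int]_(k, l)).
Variables (F : 'M[R]_(r, n)) (M : 'M[int]_(k, r)) (M' : 'M[int]_(r, k)).
Hypotheses (A_min : min_generating (fun i => row i A) (nat_comb predT (fun i => row i A)))
  (A_pos : forall x, nat_comb predT (fun i => row i A) x ->
     nat_comb predT (fun i => row i A) (- x) -> x = 0)
  (b_min : min_generating b (dual_semigroup (nat_comb predT (fun i => row i A)))).
Hypotheses (F_free : row_free F) (AE : A = map_mx intr M *m F)
  (FE : F = map_mx intr M' *m A).
Let B : 'M[R]_(l, n) := \matrix_j b j.
Hypothesis SE : realmx R S = A *m B^T.
(** Integral by construction; its columns are the dual generators in the coordinates dual to [F]. *)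
Let U : 'M[int]_(r, l) := M' *m S.

Lemma basis_coordK : M' *m M = 1%:M.
Proof.
apply: (@map_intr_real_inj R); apply: (row_free_inj F_free).
by rewrite map_mxM -mulmxA -AE -FE map_mx1 mul1mx.
Qed.

Lemma dual_coordE : map_mx intr U = F *m B^T.
Proof. by rewrite map_mxM -/(realmx R S) SE mulmxA -FE. Qed.

Lemma slack_factor : S = M *m U.
Proof.
apply: (@map_intr_real_inj R).
by rewrite map_mxM dual_coordE mulmxA -AE -SE.
Qed.

(** If [m i] were positive, the relation would put both [m i] copies of generator [i] and their
    negative in the semigroup; positivity makes that generator zero, and a zero generator can be
    omitted. *)
Lemma coord_positive (m : 'I_k -> nat) : \sum_i row i M *+ m i = 0 -> forall i, m i = 0%N.
Proof.
move=> mM i; apply/eqP/negPn/negP => mi.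
have mA : \sum_i row i A *+ m i = 0.
  transitivity (map_mx intr (\sum_i row i M *+ m i) *m F); last first.
    by rewrite mM map_mx0 mul0mx.
  rewrite map_mx_sum mulmx_suml; apply: eq_bigr => j _.
  by rewrite raddfMn/= map_row -[in RHS]scaler_nat -scalemxAl -row_mul -AE scaler_nat.
have Ai : row i A *+ m i = 0.
  apply: A_pos.
    exists (fun j => (j == i) * m j)%N; rewrite (bigD1 i)//= eqxx mul1n.
    by rewrite big1 ?addr0// => j /negPf ->.
  exists (fun j => (j != i) * m j)%N; move/eqP: mA.
  rewrite (bigD1 i)//= addrC addr_eq0 => /eqP <-.
  by rewrite [RHS](bigD1 i)//= eqxx add0r; apply: eq_bigr => j ->; rewrite mul1n.
have Ai0 : row i A = 0.
  move/eqP: Ai; rewrite -scaler_nat scaler_eq0 pnatr_eq0 (negPf mi) => /eqP //.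
apply: (proj2 A_min i); apply/seteqP; split; first exact: nat_comb_sub.
move=> _ [p ->]; exists p; rewrite (bigD1 i)//= Ai0 mul0rn add0r.
by apply: eq_bigl => j.
Qed.

Lemma dual_generator_sub j : (b j <= A)%MS.
Proof.
have /dual_semigroup_rowsP[] // :
    dual_semigroup (nat_comb predT (fun i => row i A)) (b j).
rewrite -(proj1 b_min); exists (fun i => nat_of_bool (i == j)).
by rewrite (bigD1 j)//= eqxx big1 ?addr0// => i /negPf ->.
Qed.

Lemma eqmx_basis : (A :=: F)%MS.
Proof. by apply/eqmxP/andP; split; [rewrite AE|rewrite FE]; apply: submxMl. Qed.

Lemma realcol_pairing : realcol R S = fun j => A *m (b j)^T.
Proof.
by apply/funext => j; rewrite /realcol SE colE -mulmxA -colE -tr_row rowK.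
Qed.

Lemma dual_coord_generates (u : 'cV[int]_r) : (forall i, 0 <= (M *m u) i 0) ->
  exists2 z : 'cV[int]_l, (forall j, 0 <= z j 0) & u = U *m z.
Proof.
(* As [F] is free, [pinvmx F] lifts [u] to a vector; its projection onto the span is the dual
   element with coordinates [u]. *)
move=> Mu; have [w wF Fw] := row_space_preimage F (pinvmx F *m map_mx intr u).
rewrite mulmxA mulmxVp// mul1mx in Fw.
have : dual_semigroup (nat_comb predT (fun i => row i A)) w.
  apply/dual_semigroup_rowsP; split; first by rewrite eqmx_basis.
  rewrite {1}AE -mulmxA Fw -map_mxM; apply/mxOverP => i j; rewrite ord1 mxE.
  by case: ((M *m u) i 0) (Mu i) => // p _; apply: natr_nat.
rewrite -(proj1 b_min) => -[m wE].
exists (\col_j (m j)%:Z) => [j|]; first by rewrite mxE.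
apply: (@map_intr_real_inj R); rewrite map_mxM dual_coordE -Fw -mulmxA; congr (_ *m _).
apply: trmx_inj; rewrite trmx_mul !trmxK wE mulmx_sum_row.
by apply: eq_bigr => j _; rewrite rowK !mxE -scaler_nat.
Qed.

Lemma dual_coord_unimodular : exists U' : 'M[int]_(l, r), U *m U' = 1%:M.
Proof. exact: dual_generators_unimodular coord_positive dual_coord_generates. Qed.

(** The right inverse [U'] of [U] recovers [A] as [S (U' F)]. *)
Lemma col_space_slack : col_space R S = [set y | (y^T <= A^T)%MS].
Proof.
have [U' UU'] := dual_coord_unimodular.
have SA : (A^T :=: (realmx R S)^T)%MS.
  apply/eqmxP; rewrite {2}SE trmx_mul trmxK submxMl andbT.
  have -> : A = realmx R S *m (map_mx intr U' *m F).
    by rewrite /realmx slack_factor mulmxA -map_mxM -mulmxA UU' mulmx1.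
  by rewrite trmx_mul submxMl.
by apply/seteqP; split=> y; rewrite /col_space /= SA.
Qed.

Lemma realcol_min : min_generating (realcol R S)
  ([set y | y \is a mxOver Num.nat] `&` col_space R S).
Proof.
rewrite col_space_slack realcol_pairing; apply/min_generating_pairing => // j.
exact: dual_generator_sub.
Qed.

Lemma realrow_min : min_generating (realrow R S) (row_semigroup R S).
Proof.
have [U' UU'] := dual_coord_unimodular.
(* In coordinates with respect to [F] this map is multiplication by [U], which [U'] undoes. *)
pose f : {linear 'rV[R]_n -> 'rV[R]_l} := mulmxr B^T.
have rE : realrow R S = f \o (fun i => row i A).
  by apply/funext => i; rewrite /realrow SE row_mul.
rewrite /row_semigroup rE nat_comb_image.
apply/(@min_generating_image _ _ _ f _ _ [set x | (x <= A)%MS]) => //; last 2 first.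
- by move=> _ [m ->]; apply: summx_sub => j _; rewrite -scaler_nat scalemx_sub// row_sub.
- by move=> _ [m ->]; apply: summx_sub => j _; rewrite -scaler_nat scalemx_sub// row_sub.
move=> x y; rewrite /= !eqmx_basis => /submxP[c ->] /submxP[d ->].
rewrite -!mulmxA -dual_coordE => /(congr1 (mulmxr (map_mx intr U'))) /=.
by rewrite -!mulmxA -map_mxM UU' map_mx1 !mulmx1 => ->.
Qed.

(** For integral [x = d S], the vector [z = x U' = d M] is integral, and [M' M = 1] gives
    [x = (z M') S]. *)
Lemma row_lattice_saturated :
  row_lattice R S = [set x | x \is a mxOver Num.int] `&` row_space R S.
Proof.
have [U' UU'] := dual_coord_unimodular.
apply/seteqP; split=> [_ [m ->]|x [/= xint]].
  split=> /=.
    apply/mxOverP => i j; rewrite summxE; apply: rpred_sum => h _.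
    by rewrite -scaler_int !mxE rpredM ?intr_int.
  by apply: summx_sub => i _; rewrite -scaler_int scalemx_sub// row_sub.
have [xi xE] : exists xi, x = map_mx intr xi.
  have /choice[xi xiE] j : exists p : int, x 0 j = p%:~R by apply/intrP/(mxOverP xint).
  by exists (\row_j xi j); apply/rowP => j; rewrite xiE !mxE.
rewrite /row_space /= => /submxP[d dE].
pose z := xi *m U'.
have dM : d *m map_mx intr M = map_mx intr z.
  rewrite map_mxM -xE dE /realmx slack_factor -!mulmxA -!map_mxM -(mulmxA M) UU'.
  by rewrite mulmx1.
exists (fun i => (z *m M') 0 i).
have -> : x = map_mx intr (z *m M') *m realmx R S.
  have zE : z = z *m M' *m M by rewrite -mulmxA basis_coordK mulmx1.
  by rewrite dE /realmx slack_factor map_mxM [LHS]mulmxA dM {1}zE !map_mxM -!mulmxA.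
by rewrite mulmx_sum_row; apply: eq_bigr => i _; rewrite mxE scaler_int.
Qed.

(** For nonnegative [x = d M U], the vector [d M] is nonnegative on every [U z] with [z >= 0], hence
    on every integral [w] with [M w >= 0]; Farkas' lemma then replaces [d] by a nonnegative [c]. *)
Lemma row_cone_saturated : (forall i j, 0 <= S i j) ->
  row_cone R S = [set x | x \is a mxOver Num.nneg] `&` row_space R S.
Proof.
move=> S_ge0; apply/seteqP; split=> [_ [c [c0 ->]]|x [/= xnneg]].
  split=> /=.
    apply/mxOverP => i j; rewrite summxE nnegrE sumr_ge0// => h _.
    by rewrite !mxE mulr_ge0// ler0z.
  by apply: summx_sub => i _; rewrite scalemx_sub// row_sub.
rewrite /row_space /= => /submxP[d dE].
have xE : x = (d *m map_mx intr M) *m map_mx intr U.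
  by rewrite dE /realmx slack_factor map_mxM mulmxA.
have [|c [c0 cE]] := @integral_farkas R _ _ M (d *m map_mx intr M).
  move=> w /dual_coord_generates[z z0 ->]; rewrite /pairing map_mxM mulmxA -xE mxE.
  apply: sumr_ge0 => j _; rewrite mxE mulr_ge0 ?ler0z//.
  by rewrite -nnegrE (mxOverP xnneg).
exists (fun i => c 0 i); split=> //.
by rewrite xE cE -mulmxA -map_mxM -slack_factor mulmx_sum_row.
Qed.

End IntegralFactorization.

Theorem theorem3p7 (R : realType) (k l : nat) (S : 'M[int]_(k, l))
    (S_ge0 : forall i j, 0 <= S i j) :
  (exists (n : nat) (G : set 'rV[R]_n),
      positive_affine_semigroup G /\ is_slack_matrix_of S G)
  <->
  [/\ row_cone R S = [set x | x \is a mxOver Num.nneg] `&` row_space R S,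
      row_lattice R S = [set x | x \is a mxOver Num.int] `&` row_space R S
    & min_generating (realrow R S) (row_semigroup R S)]
  /\ min_generating (realcol R S)
       ([set y | y \is a mxOver Num.nat] `&` col_space R S).
Proof.
split=> [[n [G [[[_ Giso] Gpos] [a [b [aG bG SE]]]]]]|[[_ _ Srow] Scol]]; last first.
  by exists l, (row_semigroup R S); apply: row_semigroup_slack.
pose A := \matrix_i a i.
have aE : a = fun i => row i A by apply/funext => i; rewrite rowK.
have GE : G = nat_comb predT (fun i => row i A) by rewrite -aE (proj1 aG).
rewrite {}GE {}aE in aG bG Giso Gpos SE.
have [r [F [M [M' [F_free AE FE]]]]] := lattice_basis (discrete_lattice_rows Giso).
have {}SE : realmx R S = A *m (\matrix_j b j)^T.
  apply/matrixP => i j; rewrite mxE SE /dotmx -row_mul [LHS]mxE.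
  by rewrite -[b j in LHS](rowK b) tr_row colE mulmxA -colE mxE.
split; last exact: realcol_min aG Gpos bG F_free AE FE SE.
split.
- exact: row_cone_saturated bG F_free AE FE SE S_ge0.
- exact: row_lattice_saturated aG Gpos bG F_free AE FE SE.
- exact: realrow_min aG Gpos bG F_free AE FE SE.
Qed.
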